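(* Let $m\in\mathbb N$, $m\ge1$, let $0<\alpha<1$ be fixed, and let $n\in\mathbb N$ satisfy $$n\ge\frac2\alpha\,m^2\left(\frac2\pi\log m+1\right).$$ Then the segmental Lebesgue constant $\Lambda_m(\mathcal S_m^{\mathrm{MCF}})$ associated with the quasi-nodal mock-Chebyshev segments $\mathcal S_m^{\mathrm{MCF}}$ (extracted from the $n$ equispaced segments of $[-1,1]$) satisfies $$\Lambda_m(\mathcal S_m^{\mathrm{MCF}})\le\frac1{1-\alpha}\left(\frac2\pi\log m+1\right).$$
   Context: Let $I=[-1,1]$, and let $\mathbb P_{m-1}$ be the space of real univariate polynomials of degree at most $m-1$. Equispaced segments: with $x_k=-1+\frac{2k}n$, $k=0,\dots,n$, put $s_k=[x_{k-1},x_k]$, $k=1,\dots,n$, and $\mathcal S_n^{\mathrm{eq}}=\{s_1,\dots,s_n\}$. Chebyshev nodes (roots of the Chebyshev polynomial of the first kind of degree $m$): $x_i^{\mathrm{CF}}=\cos\left(\frac{2i-1}{2m}\pi\right)$, $i=1,\dots,m$. Quasi-nodal mock-Chebyshev segments: $\mathcal S_m^{\mathrm{MCF}}=\{s_{\iota_1},\dots,s_{\iota_m}\}$, where $s_{\iota_i}\in\mathcal S_n^{\mathrm{eq}}$ is the equispaced segment containing $x_i^{\mathrm{CF}}$; if $x_i^{\mathrm{CF}}$ lies on the common endpoint of two equispaced segments, the left-hand one is chosen, i.e. $s_{\iota_i}=[x_{\iota_i-1},x_{\iota_i}]$ with $x_{\iota_i}=x_i^{\mathrm{CF}}$. Segmental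 Lebesgue constant: a set $\mathcal S=\{s_1,\dots,s_m\}$ of nondegenerate segments in $I$ is unisolvent for $\mathbb P_{m-1}$ if, for a basis $u_1,\dots,u_m$ of $\mathbb P_{m-1}$, the matrix with entries $\frac1{|s_i|}\int_{s_i}u_j(x)\,\mathrm dx$ is nonsingular. In this case the Lagrange basis $\ell_{s_1},\dots,\ell_{s_m}$ of $\mathbb P_{m-1}$ is determined by $\frac1{|s_i|}\int_{s_j}\ell_{s_i}(x)\,\mathrm dx=\delta_{ij}$, and $$\Lambda_m(\mathcal S)=\sup_{s\subset I}\frac1{|s|}\sum_{i=1}^m\left|\int_s\ell_{s_i}(x)\,\mathrm dx\right|=\max_{x\in I}\sum_{i=1}^m|\ell_{s_i}(x)|,$$ where the supremum is over nondegenerate segments $s\subset I$. *)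

(* Defs.v *)
From mathcomp Require Import all_boot all_order all_algebra.
From mathcomp Require Import all_classical all_reals all_analysis.

Set Implicit Arguments.
Unset Strict Implicit.
Unset Printing Implicit Defensive.

Import Order.TTheory GRing.Theory Num.Theory.
Import numFieldNormedType.Exports.

Local Open Scope classical_set_scope.
Local Open Scope ring_scope.

(* A segment [a, b] is represented by the pair (a, b), and a family of m
   segments by a function on 'I_m, so the indices 1, ..., m of the mathematical
   notation are shifted to 0, ..., m - 1. The space of polynomials of degree at
   most m - 1 is {poly_m R}. *)

Definition segment_in_I (R : realType) (s : R * R) : Prop :=
  [/\ -1 <= s.1, s.1 < s.2 & s.2 <= 1].

Definition seg_length (R : realType) (s : R * R) : R := s.2 - s.1.

Definition seg_integral (R : realType) (s : R * R) (p : {poly R}) : R :=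
  \int[@lebesgue_measure R]_(x in `[s.1, s.2]) p.[x].

Definition unisolvent (R : realType) (m : nat) (S : 'I_m -> R * R) : Prop :=
  (forall i, segment_in_I (S i)) /\
  exists2 u : m.-tuple {poly_m R}, basis_of fullv u &
    (\matrix_(i < m, j < m)
       ((seg_length (S i))^-1 * seg_integral (S i) (tnth u j))) \in unitmx.

Definition is_lagrange_basis (R : realType) (m : nat) (S : 'I_m -> R * R)
    (l : m.-tuple {poly_m R}) : Prop :=
  forall i j : 'I_m,
    (seg_length (S i))^-1 * seg_integral (S j) (tnth l i) = (i == j)%:R.

(* The default value [tuple 0 | _ < m] only occurs when there is no Lagrange
   basis; for a unisolvent family the Lagrange basis exists and is unique. *)
Definition lagrange_basis (R : realType) (m : nat) (S : 'I_m -> R * R) :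
    m.-tuple {poly_m R} :=
  xget [tuple 0 | _ < m] [set l | is_lagrange_basis S l].

(* Valued in \bar R because the real-valued sup of an unbounded set is 0. *)
Definition lebesgue_constant (R : realType) (m : nat) (S : 'I_m -> R * R) :
    \bar R :=
  ereal_sup [set ((seg_length s)^-1 *
      \sum_(i < m) `|seg_integral s (tnth (lagrange_basis S) i)|)%:E
    | s in [set s | segment_in_I s]].

Definition equi_node (R : realType) (n k : nat) : R := -1 + 2 * k%:R / n%:R.

(* For 1 <= k <= n *)
Definition equi_seg (R : realType) (n k : nat) : R * R :=
  (equi_node R n k.-1, equi_node R n k).

(* With i = j - 1, this is cos ((2 j - 1) pi / (2 m)). *)
Definition cheb_node (R : realType) (m : nat) (i : 'I_m) : R :=
  cos ((2 * i%:R + 1) / (2 * m%:R) * pi).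

(* The least k in {1, ..., n} such that the k-th equispaced segment contains x;
   taking the least one selects the left-hand segment when x is a common
   endpoint of two of them. *)
Definition seg_index (R : realType) (n : nat) (x : R) : nat :=
  (find (fun k => (equi_seg R n k).1 <= x <= (equi_seg R n k).2)
        (iota 1 n)).+1.

Definition mock_cheb_segments (R : realType) (n m : nat) (i : 'I_m) : R * R :=
  equi_seg R n (seg_index n (cheb_node R i)).

(* Main.v *)
Require Import Defs.
From mathcomp Require Import all_boot all_order all_algebra.
From mathcomp Require Import all_classical all_reals all_analysis.
From mathcomp Require Import ring lra.
Set Implicit Arguments.
Unset Strict Implicit.
Unset Printing Implicit Defensive.

Import Order.TTheory GRing.Theory Num.Theory.
Import numFieldNormedType.Exports.

Local Open Scope classical_set_scope.
Local Open Scope ring_scope.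

(** Write theta_k = (2 k + 1) pi / (2 m) for the Chebyshev angles and
    L = (2 / pi) ln m + 1.  The theorem is a perturbation argument around two
    facts on polynomials p with size p <= m, that is of degree at most m - 1.

    - Norming by nodes ([cheb_lebesgue_le]): |p| <= L max_k |p (cos theta_k)|
      on [-1, 1].  Interpolation at the nodes and the closed form of the
      kernel bound the Lebesgue function at cos t by |cos (m t)| / (2 m) times
      a sum of the absolute values of cot ((t +- theta_k) / 2).  That product
      has period pi / m in t, so t may be taken with |t| <= pi / (2 m); there
      each summand is largest at t = 0.  What remains is the numerical
      inequality (1 / m) sum_k cot (theta_k / 2) <= L, an equality for m = 1;
      for m >= 2 it follows from cot x <= 1 / x - x / 3 because
      sum_(k < m) 1 / (2 k + 1) - (ln m) / 2 decreases in m.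

    - Slow variation ([horner_cheb_dist]): if |p| <= B on [-1, 1] then
      |p x - p (cos theta_k)| <= 2 m^2 B |x - cos theta_k|.  The Bernstein
      inequality, obtained from the Riesz interpolation formula, says that
      p (cos t) is m B-Lipschitz in t, and the angle moves at most 2 m times as
      fast as its cosine when measured from a Chebyshev angle.

    Since |x - c| has average at most h / 2 over a segment of length h = 2 / n
    containing c, the average of p over the segment of the k-th node differs
    from p (cos theta_k) by at most (2 m^2 / n) B <= (alpha / L) B.  If all
    averages are at most E in absolute value and B is the maximum of |p|, then
    B <= L (E + (alpha / L) B), whence B <= L E / (1 - alpha)
    ([seg_norming]).  With E = 0 this is unisolvence; applied to
    sum_i e_i l_i, where l_i is the Lagrange basis and e_i the sign of its
    integral over a test segment, it bounds the Lebesgue constant. *)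

(** * Elementary bounds for sine, cosine, cotangent, the logarithm and pi *)

Lemma ge0_derive_le (R : realType) (f df : R -> R) (a b : R) :
  a <= b -> (forall x, a <= x <= b -> is_derive x 1 f (df x)) ->
  (forall x, a <= x <= b -> 0 <= df x) -> f a <= f b.
Proof.
move=> ab dfE df0.
have cf : {within `[a, b]%classic, continuous f}.
  apply: derivable_within_continuous => x xab.
  by case: (dfE x); [move: xab; rewrite in_itv /= |].
have [x|c] := @MVT_segment _ _ df _ _ ab _ cf.
  by rewrite in_itv /= => /andP[/ltW ax /ltW xb]; apply: dfE; rewrite ax.
rewrite in_itv /= => cab fab.
by rewrite -subr_ge0 fab mulr_ge0 ?subr_ge0// df0.
Qed.

Section elementary_bounds.
Context {R : realType}.
Implicit Types x t : R.

Lemma sin_le_id t : 0 <= t -> sin t <= t.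
Proof.
move=> t0; rewrite -subr_ge0.
rewrite [leLHS](_ : _ = 0 - sin 0); last by rewrite sin0 subr0.
apply: (@ge0_derive_le _ (fun x => x - sin x) (fun x => 1 - cos x)) => //.
Qed.

Lemma cos_ge_deg2 t : 0 <= t -> 1 - t ^+ 2 / 2 <= cos t.
Proof.
move=> t0; rewrite -subr_ge0.
rewrite [leLHS](_ : _ = cos 0 - (1 - 0 ^+ 2 / 2)); last by rewrite cos0; field.
apply: (@ge0_derive_le _ (fun x => cos x - (1 - x ^+ 2 / 2))
  (fun x => x - sin x)) => // x.
  by move=> _; apply: is_derive_eq; rewrite /GRing.scale /=; field.
by move=> /andP[x0 _]; rewrite subr_ge0 sin_le_id.
Qed.

Lemma sin_ge_deg3 t : 0 <= t -> t - t ^+ 3 / 6 <= sin t.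
Proof.
move=> t0; rewrite -subr_ge0.
rewrite [leLHS](_ : _ = sin 0 - (0 - 0 ^+ 3 / 6)); last by rewrite sin0; field.
apply: (@ge0_derive_le _ (fun x => sin x - (x - x ^+ 3 / 6))
  (fun x => cos x - (1 - x ^+ 2 / 2))) => // x.
  by move=> _; apply: is_derive_eq; rewrite /GRing.scale /=; field.
by move=> /andP[x0 _]; rewrite subr_ge0 cos_ge_deg2.
Qed.

Lemma cos_le_deg4 t : 0 <= t -> cos t <= 1 - t ^+ 2 / 2 + t ^+ 4 / 24.
Proof.
move=> t0; rewrite -subr_ge0.
rewrite [leLHS](_ : _ = (1 - 0 ^+ 2 / 2 + 0 ^+ 4 / 24) - cos 0); last first.
  by rewrite cos0; field.
apply: (@ge0_derive_le _ (fun x => (1 - x ^+ 2 / 2 + x ^+ 4 / 24) - cos x)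
  (fun x => sin x - (x - x ^+ 3 / 6))) => // x.
  by move=> _; apply: is_derive_eq; rewrite /GRing.scale /=; field.
by move=> /andP[x0 _]; rewrite subr_ge0 sin_ge_deg3.
Qed.

Lemma sin_le_deg5 t : 0 <= t -> sin t <= t - t ^+ 3 / 6 + t ^+ 5 / 120.
Proof.
move=> t0; rewrite -subr_ge0.
rewrite [leLHS](_ : _ = (0 - 0 ^+ 3 / 6 + 0 ^+ 5 / 120) - sin 0); last first.
  by rewrite sin0; field.
apply: (@ge0_derive_le _ (fun x => (x - x ^+ 3 / 6 + x ^+ 5 / 120) - sin x)
  (fun x => 1 - x ^+ 2 / 2 + x ^+ 4 / 24 - cos x)) => // x.
  by move=> _; apply: is_derive_eq; rewrite /GRing.scale /=; field.
by move=> /andP[x0 _]; rewrite subr_ge0 cos_le_deg4.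
Qed.

Lemma mul_cos_le_sin t : 0 <= t <= pi -> t * cos t <= sin t.
Proof.
move=> /andP[t0 tpi]; rewrite -subr_ge0.
rewrite [leLHS](_ : _ = sin 0 - 0 * cos 0); last by rewrite sin0 mul0r subr0.
apply: (@ge0_derive_le _ (fun x => sin x - x * cos x)
  (fun x => x * sin x)) => // x.
  by move=> _; apply: is_derive_eq; rewrite /GRing.scale /=; ring.
move=> /andP[x0 xt]; rewrite mulr_ge0// sin_ge0_pi// x0/=.
exact: le_trans tpi.
Qed.

(** The derivative of (1 - x^2 / 3) sin x - x cos x is
    (x / 3) (sin x - x cos x), so [mul_cos_le_sin] makes the difference of the
    two sides nondecreasing. *)
Lemma mul_cos_le_sin_deg2 t :
  0 <= t <= pi -> t * cos t <= (1 - t ^+ 2 / 3) * sin t.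
Proof.
move=> /andP[t0 tpi]; rewrite -subr_ge0.
rewrite [leLHS](_ : _ = (1 - 0 ^+ 2 / 3) * sin 0 - 0 * cos 0); last first.
  by rewrite sin0 mul0r mulr0 subr0.
apply: (@ge0_derive_le _ (fun x => (1 - x ^+ 2 / 3) * sin x - x * cos x)
  (fun x => x / 3 * (sin x - x * cos x))) => // x.
  by move=> _; apply: is_derive_eq; rewrite /GRing.scale /=; field.
move=> /andP[x0 xt]; rewrite mulr_ge0 ?divr_ge0// subr_ge0.
by rewrite mul_cos_le_sin// x0 (le_trans xt).
Qed.

Lemma cot_le t : 0 < t < pi -> cos t / sin t <= t^-1 - t / 3.
Proof.
move=> /andP[t0 tpi]; have st : 0 < sin t by rewrite sin_gt0_pi// t0.
rewrite ler_pdivrMr// -(ler_pM2l t0) mulrA.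
rewrite [t * (_ - _)](_ : _ = 1 - t ^+ 2 / 3); last by field; rewrite gt_eqF.
by rewrite mul_cos_le_sin_deg2// !ltW.
Qed.

(** The first two terms of the expansion of 2 artanh x; the cubic one makes it
    sharp enough at x = 1 / 3 for [ln2_ge]. *)
Lemma ln_ratio_ge x : 0 <= x < 1 ->
  2 * x + 2 / 3 * x ^+ 3 <= ln (1 + x) - ln (1 - x).
Proof.
move=> /andP[x0 x1]; rewrite -subr_ge0.
rewrite [leLHS](_ : _ =
    (ln (1 + 0) - ln (1 - 0)) - (2 * 0 + 2 / 3 * 0 ^+ 3)); last first.
  by rewrite addr0 subr0 ln1; ring.
apply: (@ge0_derive_le _
  (fun x => (ln (1 + x) - ln (1 - x)) - (2 * x + 2 / 3 * x ^+ 3))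
  (fun x => ((1 + x)^-1 + (1 - x)^-1) - (2 + 2 * x ^+ 2))) => // y.
  move=> /andP[y0 yx].
  have d1 : is_derive (1 + y) 1 (@ln R) (1 + y)^-1 by apply: is_derive1_ln; lra.
  have d2 : is_derive (1 - y) 1 (@ln R) (1 - y)^-1 by apply: is_derive1_ln; lra.
  have d3 : is_derive y 1 (fun z => ln (1 + z)) ((1 + y)^-1).
    have := @is_derive1_comp R (@ln R) (fun z => 1 + z) y _ _ d1 _.
    move=> /(_ _ _)/is_derive_eq; apply => //.
    by rewrite /GRing.scale /= add0r !mulr1.
  have d4 : is_derive y 1 (fun z => ln (1 - z)) (- (1 - y)^-1).
    have := @is_derive1_comp R (@ln R) (fun z => 1 - z) y _ _ d2 _.
    move=> /(_ _ _)/is_derive_eq; apply => //.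
    by rewrite /GRing.scale /= add0r mul1r mulrN1.
  by apply: is_derive_eq; rewrite /GRing.scale /=; field; apply/andP; split; lra.
move=> /andP[y0 yx].
have h : 0 < (1 + y) * (1 - y) by apply: mulr_gt0; lra.
rewrite (_ : _ - _ = 2 * y ^+ 4 / ((1 + y) * (1 - y))); last first.
  by field; apply/andP; split; lra.
by apply: divr_ge0; [apply: mulr_ge0 => //; apply: exprn_ge0|apply: ltW].
Qed.

Lemma ln2_ge : 69 / 100 <= ln 2 :> R.
Proof.
have h : ln (1 + 1 / 3) = ln 2 + ln (1 - 1 / 3) :> R.
  by rewrite -lnM ?posrE; [congr ln| |]; lra.
have := @ln_ratio_ge (1 / 3) ltac:(lra); rewrite h; lra.
Qed.

Lemma le_sin x t : - (pi / 2) <= x -> x <= t -> t <= pi / 2 -> sin x <= sin t.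
Proof.
move=> x1; rewrite le_eqVlt => /predU1P[->//|xt] t1; apply: ltW.
rewrite ltr_sin// in_itv /= ?t1 ?x1 ?andbT/=.
  exact: le_trans (ltW xt) t1.
exact: le_trans (ltW xt).
Qed.

Lemma le_cos x t : 0 <= x -> x <= t -> t <= pi -> cos t <= cos x.
Proof.
move=> x1; rewrite le_eqVlt => /predU1P[->//|xt] t1; apply: ltW.
rewrite ltr_cos// in_itv /= ?t1 ?x1 ?andbT/=.
  exact: le_trans (ltW xt) t1.
exact: le_trans (ltW xt).
Qed.

Lemma sin_pi6 : sin (pi / 6) = 1 / 2 :> R.
Proof.
have pi0 := @pi_gt0 R.
have h : cos (pi / 6 *+ 2) = sin (pi / 6) :> R.
  by rewrite -cosBpihalf -cosN; congr cos; field.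
have := cos_mulr2n (pi / 6 : R); rewrite h cos2sin2.
have s0 : 0 < sin (pi / 6) :> R by apply: sin_gt0_pi; lra.
move=> e; have : (2 * sin (pi / 6) - 1) * (sin (pi / 6) + 1) = 0 :> R by lra.
move/eqP; rewrite mulf_eq0 => /orP[]/eqP; lra.
Qed.

(** sin (pi / 6) = 1 / 2 while the Taylor bound gives sin (23 / 44) < 1 / 2. *)
Lemma pi_ge : 69 / 22 <= pi :> R.
Proof.
rewrite leNgt; apply/negP => h.
have [p0 p2] := (@pi_gt0 R, @pi_ge2 R).
(* With y = 23 / 44 and s = y^2, the Taylor polynomial of degree 5 is
   y (1 - s / 6 + s^2 / 120) <= 0.956 y < 1 / 2. *)
have [y yE] : {y : R | y = 23 / 44} by exists (23 / 44).
have ysin : sin (pi / 6) <= sin y.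
  by apply: le_sin; lra.
have [s sE] : {s : R | s = y ^+ 2} by exists (y ^+ 2).
have [s1 s2] : 27 / 100 <= s /\ s <= 28 / 100 by rewrite sE yE; split; lra.
have ss : s ^+ 2 <= 8 / 100.
  rewrite (le_trans (_ : _ <= s * (28 / 100)))//; last by lra.
  by rewrite expr2 ler_wpM2l//; lra.
have f : 1 - s / 6 + s ^+ 2 / 120 <= 956 / 1000 by lra.
have := @sin_le_deg5 y ltac:(lra).
rewrite (_ : y - _ + _ = y * (1 - s / 6 + s ^+ 2 / 120)); last first.
  by rewrite sE; field.
have yf : y * (1 - s / 6 + s ^+ 2 / 120) <= y * (956 / 1000).
  by rewrite ler_wpM2l//; lra.
move=> h1; have := le_trans (le_trans ysin h1) yf; rewrite sin_pi6 yE; lra.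
Qed.

Lemma mul_cos_cos (x y : R) : 2 * (cos x * cos y) = cos (x + y) + cos (x - y).
Proof. by rewrite cosD cosB; ring. Qed.

Lemma cos_pi4_gt0 : 0 < cos (pi / 4) :> R.
Proof. by have p0 := @pi_gt0 R; apply: cos_gt0_pihalf; lra. Qed.

Lemma sqr_cos_pi4 : 2 * (cos (pi / 4) * cos (pi / 4)) = 1 :> R.
Proof.
rewrite mul_cos_cos subrr cos0 (_ : pi / 4 + pi / 4 = pi / 2) ?cos_pihalf ?add0r//.
by field.
Qed.

Lemma sin_pi4 : sin (pi / 4) = cos (pi / 4) :> R.
Proof.
by rewrite -cosBpihalf -cosN; congr cos; field.
Qed.

End elementary_bounds.

(** * Trigonometric sums over the Chebyshev angles *)

Definition cheb_angle (R : realType) (m k : nat) : R :=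
  (2 * k%:R + 1) / (2 * m%:R) * pi.

Section cheb_sums.
Context {R : realType}.
Variable m : nat.
Hypothesis m_gt0 : (0 < m)%N.

Let mR0 : (0 : R) < m%:R. Proof. by rewrite ltr0n. Qed.

(** Multiplied by 2 sin (j pi / (2 m)) the sum telescopes to sin (j pi). *)
Lemma sum_cos_cheb_angle j : (0 < j < 2 * m)%N ->
  \sum_(k < m) cos (j%:R * cheb_angle R m k) = 0.
Proof.
move=> /andP[j0 jm].
pose d : R := j%:R / (2 * m%:R) * pi.
have jR : 0 < j%:R :> R by rewrite ltr0n.
have jmR : j%:R < 2 * m%:R :> R by rewrite -natrM ltr_nat.
have sd : 0 < sin d.
  have p0 := @pi_gt0 R.
  apply: sin_gt0_pi; rewrite /d mulr_gt0 ?divr_gt0 ?mulr_gt0//=.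
  by rewrite -[ltRHS]mul1r ltr_pM2r// ltr_pdivrMr ?mul1r ?mulr_gt0.
apply: (mulfI (lt0r_neq0 (mulr_gt0 (ltr0Sn R 1) sd))); rewrite mulr0 mulr_sumr.
rewrite -(big_mkord xpredT
  (fun k => 2 * sin d * cos (j%:R * cheb_angle R m k))).
rewrite (eq_big_nat _ _
    (F2 := fun k => sin (2 * k.+1%:R * d) - sin (2 * k%:R * d))).
  rewrite telescope_sumr// mulr0 mul0r sin0 subr0.
  rewrite (_ : 2 * m%:R * d = 0 + pi *+ j).
    have -> : pi *+ j = pi * j%:R :> R by rewrite mulr_natr.
    rewrite add0r; elim: (j) => [|i ih]; first by rewrite mulr0 sin0.
    by rewrite -natr1 mulrDr mulr1 sinDpi ih oppr0.
  by rewrite /d -[pi *+ j]mulr_natr; field; rewrite gt_eqF.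
move=> k _.
have -> : 2 * k.+1%:R * d = j%:R * cheb_angle R m k + d.
  by rewrite /d /cheb_angle -[k.+1%:R]natr1; field; rewrite gt_eqF.
have -> : 2 * k%:R * d = j%:R * cheb_angle R m k - d.
  by rewrite /d /cheb_angle; field; rewrite gt_eqF.
rewrite sinB sinD; ring.
Qed.

Lemma cheb_angle_bounds k : (k < m)%N ->
  pi / (2 * m%:R) <= cheb_angle R m k <= pi - pi / (2 * m%:R).
Proof.
move=> km; have p0 := @pi_gt0 R.
have kR : k%:R + 1 <= m%:R :> R by rewrite natr1 ler_nat.
have k0 : 0 <= k%:R :> R by [].
rewrite -subr_ge0 -[X in _ && X]subr_ge0 /cheb_angle.
have -> : (2 * k%:R + 1) / (2 * m%:R) * pi - pi / (2 * m%:R) =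
   k%:R / m%:R * pi :> R by field; rewrite gt_eqF.
have -> : pi - pi / (2 * m%:R) - (2 * k%:R + 1) / (2 * m%:R) * pi =
   (m%:R - (k%:R + 1)) / m%:R * pi :> R by field; rewrite gt_eqF.
by rewrite !mulr_ge0 ?invr_ge0 ?subr_ge0// ltW.
Qed.

Lemma cheb_angle_gt0_lt_pi k : (k < m)%N -> 0 < cheb_angle R m k < pi.
Proof.
move=> /cheb_angle_bounds/andP[h1 h2]; have p0 := @pi_gt0 R.
have d0 : 0 < pi / (2 * m%:R) :> R by rewrite divr_gt0 ?mulr_gt0.
by rewrite (lt_le_trans d0 h1)/= (le_lt_trans h2)// ltrBlDr ltrDl.
Qed.

Lemma cos_cheb_angle k : cos (m%:R * cheb_angle R m k) = 0.
Proof.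
rewrite (_ : _ * _ = pi / 2 + k%:R * pi); last first.
  by rewrite /cheb_angle; field; rewrite gt_eqF.
elim: k => [|k ih]; first by rewrite mul0r addr0 cos_pihalf.
by rewrite -[k.+1]addn1 natrD (mulrDl k%:R) mul1r addrA cosDpi ih oppr0.
Qed.

Lemma sin_cheb_angle k : sin (m%:R * cheb_angle R m k) = (-1) ^+ k.
Proof.
rewrite (_ : _ * _ = pi / 2 + k%:R * pi); last first.
  by rewrite /cheb_angle; field; rewrite gt_eqF.
elim: k => [|k ih]; first by rewrite mul0r addr0 sin_pihalf.
by rewrite -[k.+1]addn1 natrD (mulrDl k%:R) mul1r addrA sinDpi ih exprD expr1 mulrN1.
Qed.

Lemma cos_cheb_angle_lt1 k : (k < m)%N -> 0 < 1 - cos (cheb_angle R m k).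
Proof.
move=> km; have /andP[t0 tpi] := cheb_angle_gt0_lt_pi km.
by rewrite subr_gt0 -[ltRHS]cos0 ltr_cos// in_itv/= ?lexx ?pi_ge0 ?(ltW t0) ?ltW.
Qed.

End cheb_sums.

(** * Polynomials in the cosine and interpolation at the Chebyshev nodes *)

Definition cosine_sum (R : realType) (n : nat) (c : nat -> R) (t : R) : R :=
  \sum_(j < n) c j * cos (j%:R * t).

(** The class of even trigonometric polynomials of degree less than [n], in
    which p (cos t) lies: the interpolation and Riesz formulas are linear, so
    it suffices to check them on each cos (j t). *)
Definition is_cosine_sum (R : realType) (n : nat) (f : R -> R) : Prop :=
  exists c : nat -> R, f =1 cosine_sum n c.

Section cosine_sums.
Context {R : realType}.
Implicit Types f g : R -> R.

Lemma is_cosine_sumD n f g : is_cosine_sum n f -> is_cosine_sum n g ->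
  is_cosine_sum n (fun t => f t + g t).
Proof.
move=> [c fc] [d gd]; exists (fun j => c j + d j) => t.
rewrite fc gd /cosine_sum -big_split/=.
by apply: eq_bigr => j _; rewrite mulrDl.
Qed.

Lemma is_cosine_sumZ n f a : is_cosine_sum n f ->
  is_cosine_sum n (fun t => a * f t).
Proof.
move=> [c fc]; exists (fun j => a * c j) => t.
by rewrite fc /cosine_sum mulr_sumr; apply: eq_bigr => j _; rewrite mulrA.
Qed.

Lemma is_cosine_sum_sum n I (r : seq I) (P : pred I) (F : I -> R -> R) :
  (forall i, P i -> is_cosine_sum n (F i)) ->
  is_cosine_sum n (fun t => \sum_(i <- r | P i) F i t).
Proof.
move=> PF; elim: r => [|i r [c ih]].
  exists (fun=> 0) => t; rewrite big_nil /cosine_sum big1// => j _.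
  by rewrite mul0r.
case Pi : (P i); last by exists c => t; rewrite big_cons Pi ih.
have [d dE] : is_cosine_sum n (fun t => F i t + cosine_sum n c t).
  by apply: is_cosine_sumD; [exact: PF|exists c].
by exists d => t; rewrite big_cons Pi ih dE.
Qed.

Lemma is_cosine_sum_cos n j : (j < n)%N ->
  is_cosine_sum n (fun t : R => cos (j%:R * t)).
Proof.
move=> jn; exists (fun i => (i == j)%:R) => t.
rewrite /cosine_sum (bigD1 (Ordinal jn))//= eqxx mul1r big1 ?addr0// => i ij.
by rewrite (_ : (i == j :> nat) = false) ?mul0r//; apply/negbTE.
Qed.

Lemma is_cosine_sum_mul_cos n f : is_cosine_sum n f ->
  is_cosine_sum n.+1 (fun t => cos t * f t).
Proof.
move=> [c fc].
have [d dE] : is_cosine_sum n.+1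
    (fun t : R => \sum_(j < n) (c j * (cos t * cos (j%:R * t)))).
  apply: is_cosine_sum_sum => -[j jn] _; apply: is_cosine_sumZ => /=.
  case: j jn => [|j] jn.
    have [d dE] : is_cosine_sum n.+1 (fun t : R => cos (1%:R * t)).
      exact: is_cosine_sum_cos.
    by exists d => t; rewrite -dE mul0r cos0 mulr1 mul1r.
  have [d dE] : is_cosine_sum n.+1
      (fun t : R => 2^-1 * (cos (j.+2%:R * t) + cos (j%:R * t))).
    apply/is_cosine_sumZ/is_cosine_sumD; apply: is_cosine_sum_cos => //.
    by rewrite ltnS ltnW// ltnW.
  exists d => t; rewrite -dE (_ : j.+2%:R * t = j.+1%:R * t + t); last first.
    by rewrite -[j.+2%:R]natr1; ring.
  rewrite (_ : j%:R * t = j.+1%:R * t - t); last first.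
    by rewrite -[j.+1%:R]natr1; ring.
  by rewrite -mul_cos_cos mulKf// mulrC.
exists d => t; rewrite -dE fc mulr_sumr.
by apply: eq_bigr => j _; rewrite mulrCA.
Qed.

Lemma is_cosine_sum_horner (n : nat) (p : {poly R}) : (size p <= n)%N ->
  is_cosine_sum n (fun t => p.[cos t]).
Proof.
have cosX i k : is_cosine_sum (i + k).+1 (fun t : R => cos t ^+ i).
  elim: i => [|i [c cE]].
    have [c cE] := @is_cosine_sum_cos k.+1 0 (ltn0Sn _).
    by exists c => t; rewrite -cE mul0r cos0.
  have [d dE] : is_cosine_sum (i + k).+2 (fun t : R => cos t * cos t ^+ i).
    by apply: is_cosine_sum_mul_cos; exists c.
  by exists d => t; rewrite -dE exprS.
move=> pn.
have [d dE] : is_cosine_sum n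
    (fun t => \sum_(i < size p) p`_i * cos t ^+ i).
  apply: is_cosine_sum_sum => i _; apply: is_cosine_sumZ.
  have /subnKC <- : (i < n)%N by apply: leq_trans pn.
  by rewrite addSn; exact: cosX.
by exists d => t; rewrite horner_coef -dE.
Qed.

End cosine_sums.

Section cheb_interpolation.
Context {R : realType}.
Variable m : nat.
Hypothesis m_gt0 : (0 < m)%N.
Local Notation theta := (cheb_angle R m).

Lemma sum_cos_cheb_angle_eq j : (j < 2 * m)%N ->
  \sum_(k < m) cos (j%:R * theta k) = (j == 0)%:R * m%:R :> R.
Proof.
case: j => [_|j jm]; last by rewrite mul0r sum_cos_cheb_angle.
rewrite mul1r (eq_bigr (fun=> 1)) => [|k _]; last by rewrite mul0r cos0.
by rewrite sumr_const card_ord.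
Qed.

Lemma cos_cheb_orthogonal i j : (i < m)%N -> (j < m)%N ->
  \sum_(k < m) 2 * (cos (i%:R * theta k) * cos (j%:R * theta k)) =
  ((i + j == 0)%N%:R + (i == j)%:R) * m%:R :> R.
Proof.
move=> im jm; wlog ji : i j im jm / (j <= i)%N => [h|].
  have [/h ->//|/ltnW /h h1] := leqP j i.
  rewrite addnC [i == j]eq_sym -h1//.
  by apply: eq_bigr => k _; rewrite [X in 2 * X]mulrC.
under eq_bigr => k _.
  rewrite mul_cos_cos -mulrDl -mulrBl -natrD -natrB//.
  over.
rewrite big_split/= !sum_cos_cheb_angle_eq; last 2 first.
- by rewrite (leq_ltn_trans (leq_subr _ _))// (leq_trans im)// leq_pmull.
- by rewrite mul2n -addnn -addnS leq_add// ltnW.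
rewrite -mulrDl subn_eq0; congr ((_ + _%:R) * _).
by rewrite eqn_leq ji andbT.
Qed.

(** The Christoffel-Darboux kernel 1 + 2 sum_(0 < i < n) cos (i t) cos (i s)
    of the Chebyshev polynomials, the term [i = 0] being counted twice and
    corrected by the final [- 1]. *)
Definition cos_kernel (n : nat) (t s : R) : R :=
  \sum_(i < n) 2 * (cos (i%:R * t) * cos (i%:R * s)) - 1.

Lemma cos_kernelE n t s : cos_kernel n.+1 t s * (cos t - cos s) =
  cos (n.+1%:R * t) * cos (n%:R * s) - cos (n%:R * t) * cos (n.+1%:R * s).
Proof.
elim: n => [|n ih].
  by rewrite /cos_kernel big_ord1 !mul0r !mul1r cos0; ring.
rewrite /cos_kernel big_ord_recr/= addrAC mulrDl.
rewrite -[X in X * _ + _ = _]/(cos_kernel n.+1 t s) ih.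
have cosS (x : R) : cos (n.+2%:R * x) =
    2 * (cos (n.+1%:R * x) * cos x) - cos (n%:R * x).
  rewrite mul_cos_cos -[n.+2%:R]natr1 -[n.+1%:R]natr1.
  rewrite (_ : (n%:R + 1) * x - x = n%:R * x); last by ring.
  by rewrite addrK; congr cos; ring.
by rewrite !cosS; ring.
Qed.

(** By discrete orthogonality, cos_kernel m t theta_k / m is the Lagrange
    basis polynomial of the k-th node, evaluated at cos t. *)
Lemma cheb_interpolation (p : {poly R}) t : (size p <= m)%N ->
  m%:R * p.[cos t] =
  \sum_(k < m) p.[cos (theta k)] * cos_kernel m t (theta k).
Proof.
move=> /is_cosine_sum_horner[c pE]; rewrite [in LHS]pE.
under eq_bigr do rewrite pE /cosine_sum mulr_suml.
rewrite exchange_big /cosine_sum mulr_sumr/=; apply: eq_bigr => j _.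
under eq_bigr do rewrite -mulrA.
rewrite -mulr_sumr mulrCA; congr (_ * _).
under eq_bigr do rewrite mulrBr mulr1 mulr_sumr.
rewrite sumrB exchange_big/=.
rewrite (eq_bigr (fun i : 'I_m => cos (i%:R * t) *
    (((i == 0 :> nat) && (j == 0 :> nat))%:R + (i == j :> nat)%:R) * m%:R));
    last first.
  move=> i _; rewrite -addn_eq0 -mulrA -cos_cheb_orthogonal// mulr_sumr.
  by apply: eq_bigr => k _; ring.
rewrite sum_cos_cheb_angle_eq; last first.
  by rewrite (leq_trans (ltn_ord j))// leq_pmull.
rewrite -mulr_suml; under eq_bigr do rewrite mulrDr.
rewrite big_split/= (bigD1 (Ordinal m_gt0))//= mul0r cos0 mul1r.
rewrite big1 ?addr0 => [|i i0]; last first.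
  by rewrite (_ : (i == 0 :> nat) = false) ?mulr0//; apply/negbTE.
rewrite (bigD1 j)//= eqxx mulr1 big1 => [|i /negbTE ij]; last first.
  by rewrite (_ : (i == j :> nat) = false)// mulr0.
by rewrite addr0; ring.
Qed.

End cheb_interpolation.

(** * A sharp bound for a cotangent sum *)

Section odd_harmonic.
Context {R : realType}.

(** The difference of the two sides is monotone in m, because
    ln (m + 1) - ln m >= 2 / (2 m + 1), which is the first-order case of
    [ln_ratio_ge] at x = 1 / (2 m + 1). *)
Lemma odd_harmonic_le (m : nat) : (2 <= m)%N ->
  \sum_(k < m) (2 * k%:R + 1)^-1 <= 4 / 3 + (ln m%:R - ln 2) / 2 :> R.
Proof.
elim: m => // m ih; rewrite ltnS leq_eqVlt => /predU1P[<-|m2].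
  rewrite 2!big_ord_recr big_ord0 /= [leLHS](_ : _ = 4 / 3); first by lra.
  by rewrite mulr0 mulr1; field.
have {}ih := ih m2; rewrite big_ord_recr /=.
have mR : 0 < m%:R :> R by rewrite ltr0n; case: m m2 {ih}.
suff : (2 * m%:R + 1)^-1 <= (ln m.+1%:R - ln m%:R) / 2 :> R by lra.
set x : R := (2 * m%:R + 1)^-1.
have x0 : 0 < x by rewrite invr_gt0; lra.
have x1 : x < 1 by rewrite invf_lt1; lra.
have h := @ln_ratio_ge R x ltac:(lra).
have lnE : ln (1 + x) - ln (1 - x) = ln m.+1%:R - ln m%:R.
  rewrite -!ln_div ?posrE ?ltr0Sn//; [congr ln|lra|lra].
  rewrite /x -[m.+1%:R]natr1; field; apply/andP; split; lra.
have : 0 <= x ^+ 3 by rewrite exprn_ge0// ltW.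
by rewrite lnE in h; lra.
Qed.

Lemma sum_odd (m : nat) : \sum_(k < m) (2 * k%:R + 1) = m%:R ^+ 2 :> R.
Proof.
elim: m => [|m ih]; first by rewrite big_ord0 expr0n.
by rewrite big_ord_recr/= ih -[m.+1%:R]natr1; ring.
Qed.

(** By [cot_le], 1 / m times the sum is at most
    (4 / pi) sum_(k < m) 1 / (2 k + 1) - pi / 12, the linear term having the
    exact mean pi / 12.  For m = 1 this bound would be too weak, but then the
    sum is cot (pi / 4) = 1; for m >= 2 the claim becomes
    16 / 3 - 2 ln 2 <= pi + pi^2 / 12, which is why ln 2 and pi are needed to
    two decimals. *)
Lemma sum_cot_cheb_angle_le (m : nat) : (0 < m)%N ->
  \sum_(k < m) cos (cheb_angle R m k / 2) / sin (cheb_angle R m k / 2) <=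
  m%:R * (2 / pi * ln m%:R + 1).
Proof.
move=> m0; have p0 := @pi_gt0 R.
(* For m = 1 the only angle is pi / 2 and the bound is attained. *)
have [m2|] := leqP 2 m; last first.
  case: m m0 => // -[|//] _ _; rewrite big_ord1 ln1 mulr0 add0r mulr1.
  rewrite /cheb_angle mulr0 add0r mulr1.
  have -> : 1 / 2 * pi / 2 = pi / 4 :> R by field.
  have c0 : cos (pi / 4) != 0 :> R by rewrite gt_eqF// cos_gt0_pihalf//; lra.
  have := @tan_piquarter R; rewrite /tan => /(congr1 (fun x => x * cos (pi / 4))).
  by rewrite divfK// mul1r => ->; rewrite divff.
have mR : 0 < m%:R :> R by rewrite ltr0n.
apply: (@le_trans _ _ (\sum_(k < m)
   (4 * m%:R / pi * (2 * k%:R + 1)^-1 - pi / (12 * m%:R) * (2 * k%:R + 1)))).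
  apply: ler_sum => k _.
  have /andP[t0 tpi] := @cheb_angle_gt0_lt_pi R m m0 k (ltn_ord k).
  rewrite (le_trans (cot_le _))//; first by lra.
  rewrite le_eqVlt; apply/predU1P; left.
  rewrite /cheb_angle; move: (pi) p0 {t0 tpi} => p p0; field.
  by rewrite !gt_eqF//= ltr_wpDl.
rewrite sumrB -!mulr_sumr sum_odd.
have h1 := odd_harmonic_le m2.
set S := \sum_(i < m) _ in h1 *.
have h2 := @ln2_ge R; have h3 := @pi_ge R.
move: (pi) p0 h3 => p p0 h3.
rewrite -(ler_pM2l (divr_gt0 p0 mR)).
rewrite (_ : _ * (_ - _) = 4 * S - p ^+ 2 / 12); last by field; rewrite !gt_eqF.
rewrite (_ : _ * (_ * _) = 2 * ln m%:R + p); last by field; rewrite !gt_eqF.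
have h4 : 69 / 22 * (69 / 22) <= p ^+ 2 :> R.
  by rewrite expr2 ler_pM//; lra.
lra.
Qed.

End odd_harmonic.

(** * The Lebesgue function of the Chebyshev nodes *)

Definition cot (R : realType) (x : R) : R := cos x / sin x.

Section cheb_lebesgue.
Context {R : realType}.
Variable m : nat.
Hypothesis m_gt0 : (0 < m)%N.
Local Notation theta := (cheb_angle R m).
Implicit Types t u x : R.

Let mR0 : (0 : R) < m%:R. Proof. by rewrite ltr0n. Qed.

Lemma cotDpi x : cot (x + pi) = cot x.
Proof. by rewrite /cot cosDpi sinDpi invrN mulrNN. Qed.

Lemma cotN x : cot (- x) = - cot x.
Proof. by rewrite /cot cosN sinN invrN mulrN. Qed.

Lemma cos_sub_cos t x :
  cos t - cos x = - (2 * (sin ((t + x) / 2) * sin ((t - x) / 2))).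
Proof.
have -> : cos t = cos ((t + x) / 2 + (t - x) / 2) by congr cos; field.
have -> : cos x = cos ((t + x) / 2 - (t - x) / 2) by congr cos; field.
by rewrite cosD cosB; ring.
Qed.

Lemma sin_div_cos_sub_cos t x : cos t != cos x ->
  2 * (sin x / (cos t - cos x)) = cot ((t + x) / 2) - cot ((t - x) / 2).
Proof.
rewrite -subr_eq0 cos_sub_cos oppr_eq0 !mulf_eq0 pnatr_eq0/= negb_or.
move=> /andP[s1 s2].
have -> : sin x = sin ((t + x) / 2 - (t - x) / 2) by congr sin; field.
by rewrite sinB /cot; field; rewrite s1 s2.
Qed.

Lemma cos_kernel_cheb_angle k t : cos t != cos (theta k) ->
  cos_kernel m t (theta k) =
  (-1) ^+ k * cos (m%:R * t) * (sin (theta k) / (cos t - cos (theta k))).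
Proof.
move=> tk; have tk0 : cos t - cos (theta k) != 0 by rewrite subr_eq0.
apply: (mulIf tk0); rewrite -[RHS]mulrA divfK//.
have := cos_kernelE m.-1 t (theta k); rewrite prednK// => ->.
rewrite cos_cheb_angle// mulr0 subr0 -[in m.-1]subn1 natrB//.
by rewrite mulrBl mul1r cosB cos_cheb_angle// sin_cheb_angle//; ring.
Qed.

(** A sum over the 2 m zeros of cos (m t) in one period, grouped in opposite
    pairs. *)
Definition cot_sum t : R :=
  \sum_(k < m) (`|cot ((t + theta k) / 2)| + `|cot ((t - theta k) / 2)|).

(** At t away from the nodes, the kernel is, up to sign,
    cos (m t) sin theta_k / (cos t - cos theta_k), and
    2 sin theta_k / (cos t - cos theta_k) is a difference of two cotangents. *)
Lemma norm_horner_cos_le (p : {poly R}) (M t : R) : (size p <= m)%N ->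
  (forall k, (k < m)%N -> `|p.[cos (theta k)]| <= M) ->
  (forall k, (k < m)%N -> cos t != cos (theta k)) ->
  m%:R * `|p.[cos t]| <= M / 2 * (`|cos (m%:R * t)| * cot_sum t).
Proof.
move=> pm pM tk.
rewrite -[X in X * _](gtr0_norm mR0) -normrM (cheb_interpolation m_gt0)//.
rewrite (le_trans (ler_norm_sum _ _ _))// !mulr_sumr.
apply: ler_sum => k _; have {}tk := tk k (ltn_ord k).
rewrite normrM cos_kernel_cheb_angle// normrM [`|_ ^+ _ * _|]normrM.
rewrite normrX normrN1 expr1n mul1r mulrA [leRHS](_ : _ = M * `|cos (m%:R * t)| *
   ((`|cot ((t + theta k) / 2)| + `|cot ((t - theta k) / 2)|) / 2)); last by ring.
apply: ler_pM; rewrite ?mulr_ge0//; first by rewrite ler_wpM2r// pM.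
rewrite ler_pdivlMr// mulrC -[X in X * _]ger0_norm// -normrM.
by rewrite sin_div_cos_sub_cos// ler_normB.
Qed.

(** The shift by pi / m permutes the zeros of cos (m t) modulo 2 pi: in the
    sums over [theta] and over [- theta] only the end terms change, and those
    are exchanged since the cotangent has period pi. *)
Lemma cot_sum_period t : cot_sum (t + pi / m%:R) = cot_sum t.
Proof.
pose a x : R := `|cot (x / 2)|.
have shift k : theta k.+1 = theta k + pi / m%:R.
  by rewrite /cheb_angle -[k.+1%:R]natr1; field; rewrite gt_eqF.
(* The two arguments differ by 2 pi before halving. *)
have refl : a (t + theta m) = a (t - theta m.-1).
  rewrite /a (_ : (t + theta m) / 2 = (t - theta m.-1) / 2 + pi) ?cotDpi//.
  rewrite /cheb_angle -[in m.-1]subn1 natrB//.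
  by field; rewrite gt_eqF.
have refl0 : t + pi / m%:R - theta 0 = t + theta 0.
  by rewrite /cheb_angle; field; rewrite gt_eqF.
rewrite /cot_sum !big_split/=.
rewrite -(big_mkord xpredT (fun k => a (t + pi / m%:R + theta k))).
rewrite -(big_mkord xpredT (fun k => a (t + pi / m%:R - theta k))).
rewrite -(big_mkord xpredT (fun k => a (t + theta k))).
rewrite -(big_mkord xpredT (fun k => a (t - theta k))).
rewrite (eq_bigr (fun k => a (t + theta k.+1))); last first.
  by move=> k _; rewrite shift addrA addrAC.
have e1 : \sum_(0 <= k < m) a (t + theta k.+1) + a (t + theta 0) =
    \sum_(0 <= k < m) a (t + theta k) + a (t + theta m).
  by rewrite -big_nat_recr//= big_nat_recl// addrC.
have e2 : \sum_(0 <= k < m) a (t + pi / m%:R - theta k) + a (t - theta m.-1) =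
    \sum_(0 <= k < m) a (t - theta k) + a (t + theta 0).
  have recl (F : nat -> R) :
      \sum_(0 <= k < m) F k = F 0 + \sum_(0 <= k < m.-1) F k.+1.
    by rewrite -{1}(prednK m_gt0) big_nat_recl.
  have recr (F : nat -> R) :
      \sum_(0 <= k < m) F k = \sum_(0 <= k < m.-1) F k + F m.-1.
    by rewrite -{1}(prednK m_gt0) big_nat_recr.
  rewrite recl recr refl0.
  rewrite (eq_bigr (fun k => a (t - theta k))); first by ring.
  by move=> k _; rewrite shift; congr a; ring.
by move: e1 e2; rewrite refl; lra.
Qed.

(** That is, sin (n x) / sin x is nonincreasing. *)
Lemma sin_mulr_le n u b : 0 <= u <= b -> n%:R * b <= pi / 2 ->
  sin (n%:R * b) * sin u <= sin (n%:R * u) * sin b.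
Proof.
move=> /andP[u0 ub]; have p0 := @pi_gt0 R.
elim: n => [|n ih]; first by rewrite !mul0r sin0 !mul0r.
rewrite -[n.+1%:R]natr1 !(mulrDl n%:R) !mul1r => nb.
have b0 : 0 <= b by apply: le_trans ub.
have nb0 : 0 <= n%:R * b by rewrite mulr_ge0.
have nu0 : 0 <= n%:R * u by rewrite mulr_ge0.
have nub : n%:R * u <= n%:R * b by rewrite ler_wpM2l.
have {}ih := ih ltac:(lra).
have su : 0 <= sin u by apply: sin_ge0_pi; lra.
have sb : 0 <= sin b by apply: sin_ge0_pi; lra.
have snb : 0 <= sin (n%:R * b) by apply: sin_ge0_pi; lra.
have cb : 0 <= cos b by apply: cos_ge0_pihalf; lra.
have cub : cos b <= cos u by apply: le_cos; lra.
have cn : cos (n%:R * b) <= cos (n%:R * u) by apply: le_cos; lra.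
rewrite !sinD !mulrDl; apply: lerD.
  rewrite mulrAC [leRHS]mulrAC ler_pM// mulr_ge0//.
rewrite -!mulrA [sin b * sin u]mulrC ler_wpM2r// mulr_ge0//.
Qed.

Lemma cos_sin_half x : cos x = 1 - 2 * sin (x / 2) ^+ 2.
Proof.
have -> : cos x = cos (x / 2 + x / 2) by congr cos; field.
rewrite cosD; have := cos2Dsin2 (x / 2); lra.
Qed.

(** In terms of half angles the claim is
    sin^2 u <= 2 sin^2 (m u) sin^2 (theta_k / 2) with u = |t| / 2; the worst
    theta_k is the smallest one, pi / (2 m), and then it is [sin_mulr_le] for
    b = pi / (4 m), as sin^2 (m b) = 1 / 2. *)
Lemma cos_mulr_cheb_le k t : (k < m)%N -> `|t| <= pi / (2 * m%:R) ->
  cos (m%:R * t) * (1 - cos (theta k)) <= cos t - cos (theta k).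
Proof.
move=> km tm; have p0 := @pi_gt0 R.
have /andP[th1 th2] := @cheb_angle_bounds R m m_gt0 k km.
have /andP[th0 thpi] := @cheb_angle_gt0_lt_pi R m m_gt0 k km.
rewrite -(cos_norm t) -(cos_norm (m%:R * t)) normrM (gtr0_norm mR0).
set u := `|t| / 2; set a := theta k / 2; set b : R := pi / (2 * m%:R) / 2.
rewrite (cos_sin_half `|t|) (cos_sin_half (m%:R * `|t|)) (cos_sin_half (theta k)).
rewrite -/u -/a (_ : m%:R * `|t| / 2 = m%:R * u); last by rewrite mulrA.
have u0 : 0 <= u by rewrite divr_ge0.
have ub : u <= b by rewrite ler_pM2r.
have mb : m%:R * b = pi / 4 by rewrite /b; field; rewrite gt_eqF.
have mu : m%:R * u <= pi / 4 by rewrite -mb ler_wpM2l// ltW.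
have mu0 : 0 <= m%:R * u by rewrite mulr_ge0// ltW.
have ba : sin b <= sin a.
  have d0 : 0 < pi / (2 * m%:R) :> R by rewrite divr_gt0 ?mulr_gt0.
  apply: le_sin; rewrite /a /b; move: th1 d0;
    by set d := pi / (2 * _) => *; lra.
have h : cos (pi / 4) * sin u <= sin (m%:R * u) * sin a.
  rewrite (le_trans (_ : _ <= sin (m%:R * u) * sin b))//.
    rewrite -sin_pi4 -mb sin_mulr_le ?u0// mb; lra.
  by rewrite ler_wpM2l//; apply: sin_ge0_pi; lra.
have r2 := @sqr_cos_pi4 R; have r0 := @cos_pi4_gt0 R.
have su : 0 <= sin u.
  apply: sin_ge0_pi; rewrite u0/= (le_trans ub)//.
  by move: th1; rewrite /b; set d := pi / (2 * _) => th1; lra.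
have h2 : (cos (pi / 4) * sin u) ^+ 2 <= (sin (m%:R * u) * sin a) ^+ 2.
  by rewrite ler_sqr ?nnegrE// ?(le_trans _ h)// mulr_ge0// ltW.
have : sin u ^+ 2 = 2 * (cos (pi / 4) * sin u) ^+ 2.
  by rewrite exprMn mulrA expr2 r2 mul1r.
by move: h2; rewrite [leRHS]exprMn; set y := _ * sin u; lra.
Qed.

(** For |t| <= pi / (2 m) the two cotangents of a pair have opposite signs, so
    their absolute values add up to
    2 sin theta_k / (cos t - cos theta_k), and [cos_mulr_cheb_le] compares
    the product with its value at t = 0. *)
Lemma cot_sum_near0_le t : `|t| <= pi / (2 * m%:R) ->
  `|cos (m%:R * t)| * cot_sum t <= 2 * \sum_(k < m) cot (theta k / 2).
Proof.
move=> tm; have p0 := @pi_gt0 R.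
have cm0 : 0 <= cos (m%:R * t).
  rewrite -cos_norm normrM (gtr0_norm mR0).
  have h : m%:R * `|t| <= pi / 2.
    rewrite (le_trans (ler_wpM2l (ltW mR0) tm))//.
    by rewrite le_eqVlt; apply/predU1P; left; field; rewrite gt_eqF.
  by apply: cos_ge0_pihalf; have := mulr_ge0 (ltW mR0) (normr_ge0 t); lra.
rewrite ger0_norm// !mulr_sumr; apply: ler_sum => k _.
have /andP[th1 th2] := @cheb_angle_bounds R m m_gt0 k (ltn_ord k).
have /andP[th0 thpi] := @cheb_angle_gt0_lt_pi R m m_gt0 k (ltn_ord k).
have cmt := cos_mulr_cheb_le (ltn_ord k) tm.
have cot0 : 0 <= cot (theta k / 2).
  rewrite divr_ge0//; first by apply: cos_ge0_pihalf; lra.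
  by apply: sin_ge0_pi; lra.
have [->|cm1] := eqVneq (cos (m%:R * t)) 0; first by rewrite mul0r mulr_ge0.
have cmp : 0 < cos (m%:R * t) by rewrite lt_neqAle eq_sym cm1.
have th1p := @cos_cheb_angle_lt1 R m m_gt0 k (ltn_ord k).
have tth : 0 < cos t - cos (theta k) by rewrite (lt_le_trans _ cmt)// mulr_gt0.
have /andP[t1 t2] : - theta k <= t <= theta k.
  by rewrite -ler_norml (le_trans tm).
have cotge0 x : 0 <= x <= pi / 2 -> 0 <= cot x.
  move=> x0; rewrite divr_ge0//; first by apply: cos_ge0_pihalf; lra.
  by apply: sin_ge0_pi; lra.
move: (tm); rewrite ler_norml => /andP[tm1 tm2].
rewrite ger0_norm; last first.
  by apply: cotge0; move: tm2 th2; set d := pi / (2 * _) => *; lra.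
rewrite ler0_norm; last first.
  rewrite -oppr_ge0 -cotN; apply: cotge0.
  by move: tm1 th2; set d := pi / (2 * _) => *; lra.
rewrite -sin_div_cos_sub_cos; last by rewrite -subr_eq0 gt_eqF.
have := @sin_div_cos_sub_cos 0 (theta k).
rewrite cos0 add0r sub0r mulNr cotN opprK => /(_ _) h.
have {}h : 2 * (sin (theta k) / (1 - cos (theta k))) = 2 * cot (theta k / 2).
  by rewrite h; [ring|rewrite -subr_eq0 gt_eqF].
rewrite -h mulrCA ler_pM2l// mulrCA ler_wpM2l ?sin_ge0_pi ?(ltW th0) ?(ltW thpi)//.
by rewrite ler_pdivrMr// [leRHS]mulrC ler_pdivlMr.
Qed.

(** Shifts by the period pi / m bring t into the interval of
    [cot_sum_near0_le]. *)
Lemma cot_sum_le t : 0 <= t <= pi ->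
  `|cos (m%:R * t)| * cot_sum t <= 2 * \sum_(k < m) cot (theta k / 2).
Proof.
move=> /andP[t0 tpi]; have p0 := @pi_gt0 R.
pose d : R := pi / (2 * m%:R).
have d0 : 0 < d by rewrite divr_gt0 ?mulr_gt0.
have dE : pi / m%:R = 2 * d by rewrite /d; field; rewrite gt_eqF.
have piE : pi = m%:R * (2 * d) by rewrite -dE mulrC divfK// gt_eqF.
have gen n : forall t, - d <= t <= d + n%:R * (2 * d) ->
    `|cos (m%:R * t)| * cot_sum t <= 2 * \sum_(k < m) cot (theta k / 2).
  elim: n => [|n ih] {t t0 tpi} t /andP[t1 t2].
    by apply: cot_sum_near0_le; rewrite ler_norml -/d; lra.
  have [td|dt] := leP t d.
    by apply: cot_sum_near0_le; rewrite ler_norml -/d t1.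
  have := ih (t - 2 * d).
  rewrite -(cot_sum_period (t - 2 * d)) dE subrK.
  rewrite (_ : `|cos (m%:R * (t - 2 * d))| = `|cos (m%:R * t)|); last first.
    rewrite -normrN -cosDpi; congr `|cos _|.
    by rewrite [X in _ + X]piE; ring.
  by apply; move: t2; rewrite -[n.+1%:R]natr1 => t2; apply/andP; split; lra.
by apply: (gen m); rewrite -piE; lra.
Qed.

Lemma cheb_lebesgue_le (p : {poly R}) (M x : R) : (size p <= m)%N ->
  (forall k, (k < m)%N -> `|p.[cos (theta k)]| <= M) -> -1 <= x <= 1 ->
  `|p.[x]| <= (2 / pi * ln m%:R + 1) * M.
Proof.
move=> pm pM x1; have p0 := @pi_gt0 R.
have M0 : 0 <= M by apply: le_trans (pM 0 m_gt0).
have lnm : 0 <= 2 / pi * ln m%:R :> R.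
  by rewrite mulr_ge0 ?ln_ge0 ?ler1n// divr_ge0// ltW.
rewrite -(acosK (x := x)) ?in_itv//; set t := acos x.
have t0 : 0 <= t <= pi by rewrite acos_ge0 ?acos_lepi.
have [[k km /eqP ->]|nk] :=
    pselect (exists2 k, (k < m)%N & cos t == cos (theta k)).
  by rewrite (le_trans (pM _ km))// ler_peMl// lerDr.
rewrite -(ler_pM2l mR0); apply: le_trans.
  apply: norm_horner_cos_le pm pM _ => k km.
  by apply/negP => h; apply: nk; exists k.
rewrite (le_trans (ler_wpM2l _ (cot_sum_le t0))) ?divr_ge0//.
rewrite mulrA divfK// mulrA mulrC ler_wpM2r//.
exact: sum_cot_cheb_angle_le.
Qed.

End cheb_lebesgue.

(** * Riesz interpolation formula and the Bernstein inequality *)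

Section riesz.
Context {R : realType}.
Variable m : nat.
Hypothesis m_gt0 : (0 < m)%N.
Local Notation theta := (cheb_angle R m).

Let mR0 : (0 : R) < m%:R. Proof. by rewrite ltr0n. Qed.

(** The second difference in [i] of the left-hand side is
    - 2 sum_k cos (i theta_k), which vanishes, and the first difference at
    [i = 0] is - m. *)
Lemma sum_cos_div_affine i : (i <= m)%N ->
  \sum_(k < m) cos (i%:R * theta k) / (1 - cos (theta k)) =
  \sum_(k < m) (1 - cos (theta k))^-1 - i%:R * m%:R.
Proof.
have nz k : (k < m)%N -> 1 - cos (theta k) != 0.
  by move=> km; rewrite gt_eqF// cos_cheb_angle_lt1.
elim/ltn_ind: i => -[_ _|[_ _|i ih im]].
- rewrite mul0r subr0; apply: eq_bigr => k _.
  by rewrite mul0r cos0 mul1r.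
- have <- : \sum_(k < m) 1 = m%:R :> R by rewrite sumr_const card_ord.
  rewrite mul1r -sumrB.
  apply: eq_bigr => k _; rewrite mul1r.
  by field; exact: nz.
- have := ih i.+1 (ltnSn _) (ltnW im).
  have := ih i (ltnW (ltnSn _)) (ltnW (ltnW im)).
  have := @sum_cos_cheb_angle R m m_gt0 i.+1.
  rewrite /= (leq_trans im) ?leq_pmull// => /(_ isT).
  move=> h0 h1 h2.
  rewrite (_ : \sum_(k < m) _ =
    2 * (\sum_(k < m) cos (i.+1%:R * theta k) / (1 - cos (theta k))) -
    \sum_(k < m) cos (i%:R * theta k) / (1 - cos (theta k)) -
    2 * \sum_(k < m) cos (i.+1%:R * theta k)).
    by rewrite h0 h1 h2 -[i.+2%:R]natr1 -[i.+1%:R]natr1; ring.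
  rewrite !mulr_sumr -!sumrB; apply: eq_bigr => k _.
  have -> : i.+2%:R * theta k = i.+1%:R * theta k + theta k.
    by rewrite -[i.+2%:R]natr1; ring.
  have -> : i%:R * theta k = i.+1%:R * theta k - theta k.
    by rewrite -[i.+1%:R]natr1; ring.
  by rewrite cosD cosB; field; exact: nz.
Qed.

(** Case i = m of [sum_cos_div_affine], where all the cosines vanish. *)
Lemma sum_inv_1_sub_cos : \sum_(k < m) (1 - cos (theta k))^-1 = m%:R ^+ 2.
Proof.
have := sum_cos_div_affine (leqnn m).
rewrite big1 => [|k _]; last by rewrite cos_cheb_angle// mul0r.
by move/esym/subr0_eq; rewrite expr2.
Qed.

Lemma sum_cos_div i : (i <= m)%N ->
  \sum_(k < m) cos (i%:R * theta k) / (1 - cos (theta k)) =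
  m%:R * (m%:R - i%:R).
Proof. by move=> im; rewrite sum_cos_div_affine// sum_inv_1_sub_cos; ring. Qed.

(** Weights of the Riesz formula
    f' t = sum_k riesz_weight k * (f (t + theta_k) - f (t - theta_k)). *)
Definition riesz_weight (k : nat) : R :=
  (-1) ^+ k / (2 * m%:R * (1 - cos (theta k))).

(** As cos (m theta_k) = 0 and sin (m theta_k) = (-1)^k, the weight turns
    sin (j theta_k) into cos ((m - j) theta_k) / (1 - cos theta_k), whose sum is
    [sum_cos_div]. *)
Lemma riesz_cos j t : (j <= m)%N ->
  \sum_(k < m) riesz_weight k *
     (cos (j%:R * (t + theta k)) - cos (j%:R * (t - theta k))) =
  - (j%:R * sin (j%:R * t)).
Proof.
move=> jm.
rewrite (eq_bigr (fun k : 'I_m => - (sin (j%:R * t) / m%:R) *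
    (cos ((m - j)%:R * theta k) / (1 - cos (theta k))))).
  rewrite -mulr_sumr sum_cos_div ?leq_subr// natrB//.
  by field; rewrite gt_eqF.
move=> k _.
rewrite natrB// mulrBl cosB cos_cheb_angle// mul0r add0r sin_cheb_angle//.
rewrite [_ * (t + _)]mulrDr [_ * (t - _)]mulrBr cosD cosB /riesz_weight.
have h := @cos_cheb_angle_lt1 R m m_gt0 k (ltn_ord k).
by field; rewrite !gt_eqF.
Qed.

Lemma sum_norm_riesz_weight : \sum_(k < m) `|riesz_weight k| = m%:R / 2.
Proof.
rewrite (eq_bigr (fun k : 'I_m => (2 * m%:R)^-1 * (1 - cos (theta k))^-1)).
  rewrite -mulr_sumr sum_inv_1_sub_cos; field; rewrite gt_eqF//.
move=> k _; have h := @cos_cheb_angle_lt1 R m m_gt0 k (ltn_ord k).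
rewrite /riesz_weight normrM normrX normrN1 expr1n mul1r normfV gtr0_norm.
  by rewrite invfM.
by rewrite !mulr_gt0.
Qed.

(** The Riesz formula bounds the derivative by 2 B times the sum of the
    absolute weights, which is m / 2. *)
Lemma bernstein_lipschitz (f : R -> R) (B : R) : is_cosine_sum m f ->
  (forall t, `|f t| <= B) ->
  forall s t, `|f s - f t| <= m%:R * B * `|s - t|.
Proof.
move=> [c fE] fB.
pose df t := \sum_(k < m) riesz_weight k * (f (t + theta k) - f (t - theta k)).
have fD (t : R) : is_derive t 1 f (df t).
  have -> : f = \sum_(j < m) (fun t => c j * cos (j%:R * t)).
    by apply/funext => x; rewrite fE /cosine_sum fct_sumE.
  have dj (j : 'I_m) : is_derive t 1 (fun t => c j * cos (j%:R * t))
      (c j * - (j%:R * sin (j%:R * t))).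
    have d1 : is_derive t 1 (fun t : R => j%:R * t) j%:R.
      by apply: is_derive_eq; rewrite /GRing.scale /= mulr1.
    have d2 := @is_derive1_comp R (@cos R) _ t _ _ (is_derive_cos _) d1.
    have d3 := is_deriveZ (c j) d2.
    by apply: is_derive_eq; rewrite /GRing.scale /=; ring.
  apply: is_derive_eq.
  rewrite /df; under [RHS]eq_bigr do rewrite !fE /cosine_sum -sumrB mulr_sumr.
  rewrite exchange_big/=; apply: eq_bigr => j _.
  rewrite -riesz_cos ?(ltnW (ltn_ord j))// mulr_sumr.
  by apply: eq_bigr => k _; ring.
have dfB t : `|df t| <= m%:R * B.
  apply: (le_trans (ler_norm_sum _ _ _)).
  rewrite [leRHS](_ : _ = (m%:R / 2) * (2 * B)); last by field.
  rewrite -sum_norm_riesz_weight mulr_suml; apply: ler_sum => k _.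
  rewrite normrM ler_wpM2l//.
  by rewrite (le_trans (ler_normB _ _))// mulr_natl mulr2n lerD.
move=> s t; wlog st : s t / s <= t => [h|].
  by have [|/ltW] := leP s t => /h//; rewrite distrC [`|t - s|]distrC.
have cf : {within `[s, t], continuous f}.
  by apply: derivable_within_continuous => x _; case: (fD x).
have [x _ fst] := @MVT_segment _ f df _ _ st (fun x _ => fD x) cf.
by rewrite distrC fst normrM [`|s - t|]distrC ler_wpM2r.
Qed.

End riesz.

(** * Variation of a polynomial near a Chebyshev node *)

Section cheb_angle_distance.
Context {R : realType}.
Implicit Types t u v x : R.

Lemma norm_sin_mulrn n x : `|sin (n%:R * x)| <= n%:R * `|sin x|.
Proof.
elim: n => [|n ih]; first by rewrite !mul0r sin0 normr0.
rewrite -[n.+1%:R]natr1 !mulrDl !mul1r sinD (le_trans (ler_normD _ _))//.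
rewrite !normrM lerD//.
  by rewrite (le_trans _ ih)// ler_piMr// cos_max.
by rewrite ler_piMl// cos_max.
Qed.

Lemma sin_le_between (a u : R) : 0 <= a <= pi / 2 -> a <= u <= pi - a ->
  sin a <= sin u.
Proof.
move=> /andP[a0 api] /andP[au ua]; have p0 := @pi_gt0 R.
have [upi|/ltW upi] := leP u (pi / 2); first by apply: le_sin => //; lra.
rewrite -[leRHS]opprK -sinN -sinDpi; apply: le_sin; lra.
Qed.

(** With u = (t + theta_k) / 2 and v = |t - theta_k| / 2 one has
    |cos t - cos theta_k| = 2 sin u sin v, and the claim is
    v <= 2 m sin u sin v.  If v <= pi / 4 then sin v >= v cos v >= v / sqrt 2,
    while u stays at distance pi / (4 m) from 0 and pi, so that
    m sin u >= m sin (pi / (4 m)) >= sin (pi / 4).  If v >= pi / 4 both sines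
    are at least 1 / sqrt 2, and v <= m. *)
Lemma cheb_angle_dist m k t : (k < m)%N -> 0 <= t <= pi ->
  `|t - cheb_angle R m k| <= 2 * m%:R * `|cos t - cos (cheb_angle R m k)|.
Proof.
move=> km /andP[t0 tpi]; have p0 := @pi_gt0 R.
have m0 : (0 < m)%N by apply: leq_trans km.
have mR : 0 < m%:R :> R by rewrite ltr0n.
have := @cheb_angle_bounds R m m0 k km.
set th := cheb_angle R m k; set d := pi / (2 * m%:R) => /andP[th1 th2].
have d0 : 0 < d by rewrite divr_gt0 ?mulr_gt0.
have dpi : d <= pi / 2.
  rewrite /d ler_pdivrMr ?mulr_gt0// mulrA divfK// ler_peMr ?ler1n//.
  exact: ltW.
pose u := (t + th) / 2; pose v := `|t - th| / 2.
have v0 : 0 <= v by rewrite divr_ge0.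
have vu : v <= u.
  by rewrite ler_pM2r ?invr_gt0// ler_norml; apply/andP; split; lra.
have vpiu : v <= pi - u.
  rewrite /v /u ler_pdivrMr// ler_norml; apply/andP; split; lra.
have vmax : v <= (pi - d) / 2.
  by rewrite ler_pM2r ?invr_gt0// ler_norml; apply/andP; split; lra.
have -> : `|cos t - cos th| = 2 * (sin u * sin v).
  have -> : cos t - cos th = - (2 * (sin u * sin ((t - th) / 2))).
    rewrite {1}(_ : t = u + (t - th) / 2); last by rewrite /u; field.
    rewrite {2}(_ : th = u - (t - th) / 2); last by rewrite /u; field.
    by rewrite cosD cosB; ring.
  have su : 0 <= sin u by apply: sin_ge0_pi; rewrite /u; lra.
  have sv : 0 <= sin v by apply: sin_ge0_pi; rewrite v0/=; lra.
  rewrite normrN !normrM (ger0_norm su) (ger0_norm (_ : 0 <= 2))//.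
  congr (_ * (_ * _)); move: sv; rewrite /v.
  case: (ger0P (t - th)) => h; first exact: ger0_norm.
  by rewrite mulNr sinN oppr_ge0; exact: ler0_norm.
rewrite (_ : `|t - th| = 2 * v); last by rewrite /v; field.
rewrite -mulrA ler_pM2l//.
have r0 := @cos_pi4_gt0 R; have r2 := @sqr_cos_pi4 R.
set r := cos (pi / 4) in r0 r2.
have [vpi|/ltW vpi] := leP v (pi / 4).
  have sv : r * v <= sin v.
    rewrite (le_trans _ (mul_cos_le_sin _))//; last by lra.
    by rewrite mulrC ler_wpM2l// le_cos//; lra.
  have su : r <= m%:R * sin u.
    apply: (@le_trans _ _ (m%:R * sin (d / 2))); last first.
      by rewrite ler_pM2l// sin_le_between//; rewrite /u; lra.
    rewrite /r -sin_pi4.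
    have := norm_sin_mulrn m (d / 2).
    rewrite (_ : m%:R * (d / 2) = pi / 4).
      rewrite !ger0_norm//; apply: sin_ge0_pi; lra.
    by rewrite /d; field; rewrite gt_eqF.
  rewrite [leRHS](_ : _ = 2 * ((m%:R * sin u) * sin v)); last by ring.
  have vE : v = 2 * (r * (r * v)).
    by transitivity (2 * (r * r) * v); [rewrite r2 mul1r|ring].
  by rewrite [leLHS]vE ler_pM2l// ler_pM// ?mulr_ge0// ltW.
have sv : r <= sin v by rewrite /r -sin_pi4 le_sin//; lra.
have su : r <= sin u by rewrite (le_trans sv)// sin_le_between//; lra.
have h : 1 <= 2 * (sin u * sin v).
  by rewrite -[leLHS]r2 ler_pM2l// ler_pM// ltW.
apply: le_trans (ler_wpM2l (ltW mR) h); rewrite mulr1.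
have [m1|] := leqP 2 m.
  have : 2 <= m%:R :> R by rewrite ler_nat.
  by have := @pihalf_lt2 R; lra.
case: (m) m0 @d {th1 th2 d0 dpi} vmax => [|[|//]]// _ /=; rewrite mulr1.
by have := @pihalf_lt2 R; lra.
Qed.

Lemma horner_cheb_dist m k (p : {poly R}) (B x : R) :
  (k < m)%N -> (size p <= m)%N ->
  (forall x, -1 <= x <= 1 -> `|p.[x]| <= B) -> -1 <= x <= 1 ->
  `|p.[x] - p.[cos (cheb_angle R m k)]| <=
    2 * m%:R ^+ 2 * B * `|x - cos (cheb_angle R m k)|.
Proof.
move=> km pm pB x1.
have m0 : (0 < m)%N by apply: leq_trans km.
have B0 : 0 <= B by rewrite (le_trans _ (pB x x1)).
rewrite -(acosK (x := x)) ?in_itv//; set t := acos x.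
apply: le_trans.
  apply: (bernstein_lipschitz m0 (is_cosine_sum_horner pm) (B := B)) => s.
  by rewrite pB// cos_geN1 cos_le1.
rewrite (_ : 2 * _ * B = m%:R * B * (2 * m%:R)); last by ring.
rewrite -[leRHS]mulrA ler_wpM2l ?mulr_ge0// cheb_angle_dist//.
by rewrite acos_ge0 ?acos_lepi.
Qed.

End cheb_angle_distance.

(** * Averages of polynomials over segments *)

Section segment_integrals.
Context {R : realType}.
Implicit Types (s : R * R) (p q : {poly R}) (a : R).
Local Notation mu := (@lebesgue_measure R).

Lemma integrable_horner s p : mu.-integrable `[s.1, s.2] (EFin \o horner p).
Proof.
apply: continuous_compact_integrable; first exact: segment_compact.
by apply: continuous_subspaceT => x; exact: continuous_horner.
Qed.

Lemma seg_integralD s p q :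
  seg_integral s (p + q) = seg_integral s p + seg_integral s q.
Proof.
rewrite /seg_integral -RintegralD//; try exact: integrable_horner.
by apply: eq_Rintegral => x _; rewrite hornerD.
Qed.

Lemma seg_integralZ s a p : seg_integral s (a *: p) = a * seg_integral s p.
Proof.
rewrite /seg_integral -RintegralZl//; last exact: integrable_horner.
by apply: eq_Rintegral => x _; rewrite hornerZ.
Qed.

Lemma seg_integral0 s : seg_integral s 0 = 0.
Proof. by rewrite -(scale0r 0) seg_integralZ mul0r. Qed.

Lemma seg_integral_sum s I (r : seq I) (P : pred I) (F : I -> {poly R}) :
  seg_integral s (\sum_(i <- r | P i) F i) =
  \sum_(i <- r | P i) seg_integral s (F i).
Proof. exact: (big_morph _ (seg_integralD s) (seg_integral0 s)). Qed.

Lemma seg_integral_le s p q :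
  (forall x, s.1 <= x <= s.2 -> p.[x] <= q.[x]) ->
  seg_integral s p <= seg_integral s q.
Proof.
move=> pq; apply: le_Rintegral => //; try exact: integrable_horner.
Qed.

Lemma seg_integralC s a : s.1 < s.2 ->
  seg_integral s a%:P = a * seg_length s.
Proof.
move=> s12; rewrite /seg_integral.
under eq_Rintegral do rewrite hornerC.
rewrite Rintegral_cst; [|exact: measurable_itv].
rewrite (_ : fine _ = seg_length s)//.
by rewrite [X in fine X]lebesgue_measure_itv /= lte_fin s12.
Qed.

Lemma seg_integralX s : s.1 < s.2 ->
  seg_integral s 'X = (s.2 ^+ 2 - s.1 ^+ 2) / 2.
Proof.
move=> s12; rewrite /seg_integral /Rintegral.
under eq_integral do rewrite hornerX.
have d (x : R) : is_derive x 1 (fun x : R => x ^+ 2 / 2) x.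
  by apply: is_derive_eq; rewrite /GRing.scale /=; field.
rewrite (@continuous_FTC2 _ id (fun x : R => x ^+ 2 / 2))//=; first by field.
- by apply: continuous_subspaceT => x; exact: cvg_id.
- have cf (x : R) : {for x, continuous (fun x : R => x ^+ 2 / 2)}.
    by apply: differentiable_continuous; apply/derivable1_diffP; case: (d x).
  split.
  + by move=> x _; case: (d x).
  + by apply: cvg_at_right_filter; exact: cf.
  + by apply: cvg_at_left_filter; exact: cf.
- by move=> x _; rewrite derive1E; case: (d x).
Qed.

(** On [s] the convex function |x - c| lies below the chord [q] through its
    end values, and the mean of [q] is half the length of [s].  Comparing with
    a polynomial keeps the argument inside the integrals of polynomials. *)
Lemma seg_average_dist s p (c K : R) : s.1 < s.2 -> s.1 <= c <= s.2 -> 0 <= K ->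
  (forall x, s.1 <= x <= s.2 -> `|p.[x] - p.[c]| <= K * `|x - c|) ->
  `|(seg_length s)^-1 * seg_integral s p - p.[c]| <= K * seg_length s / 2.
Proof.
move=> s12 /andP[s1c cs2] K0 pK.
have l0 : 0 < seg_length s by rewrite subr_gt0.
(* [q] takes the values c - s.1 at s.1 and s.2 - c at s.2. *)
pose A := (s.2 * (c - s.1) - s.1 * (s.2 - c)) / seg_length s.
pose B := ((s.2 - c) - (c - s.1)) / seg_length s.
pose q : {poly R} := A%:P + B *: 'X.
have qE x : s.1 <= x <= s.2 -> `|x - c| <= q.[x].
  move=> /andP[x1 x2]; rewrite !hornerE -(ler_pM2l l0).
  rewrite (_ : _ * (A + _) = (s.2 - x) * (c - s.1) + (x - s.1) * (s.2 - c)).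
    have h1 : 0 <= (x - s.1) * (s.2 - c) by rewrite mulr_ge0 ?subr_ge0.
    have h2 : 0 <= (s.2 - x) * (c - s.1) by rewrite mulr_ge0 ?subr_ge0.
    rewrite /seg_length; case: (ger0P (x - c)) => _; lra.
  by rewrite /A /B /seg_length; field; rewrite subr_eq0 gt_eqF.
have qI : seg_integral s q = seg_length s ^+ 2 / 2.
  rewrite seg_integralD seg_integralZ seg_integralC// seg_integralX//.
  by rewrite /A /B /seg_length; field; rewrite subr_eq0 gt_eqF.
have hx x : s.1 <= x <= s.2 -> `|p.[x] - p.[c]| <= K * q.[x].
  by move=> sx; rewrite (le_trans (pK _ sx))// ler_wpM2l// qE.
have up : seg_integral s p <= p.[c] * seg_length s + K * (seg_length s ^+ 2 / 2).
  rewrite -qI -seg_integralC// -seg_integralZ -seg_integralD.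
  apply: seg_integral_le => x /hx.
  by rewrite hornerD hornerZ hornerC ler_norml => /andP[_]; lra.
have lo : p.[c] * seg_length s - K * (seg_length s ^+ 2 / 2) <= seg_integral s p.
  rewrite -qI -seg_integralC// -mulNr -seg_integralZ -seg_integralD.
  apply: seg_integral_le => x /hx.
  by rewrite hornerD hornerZ hornerC ler_norml => /andP[]; lra.
rewrite -(ler_pM2l l0) -[X in X * `|_|]gtr0_norm// -normrM mulrBr.
rewrite mulVKf ?gt_eqF// ler_norml; apply/andP; split; lra.
Qed.

End segment_integrals.

(** * Equispaced segments, and transfer from nodes to segments *)

Section equispaced.
Context {R : realType}.

Lemma equi_seg_in_I (n k : nat) : (0 < k <= n)%N ->
  segment_in_I (equi_seg R n k) /\ seg_length (equi_seg R n k) = 2 / n%:R.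
Proof.
case: k => // k /=; rewrite /equi_seg /seg_length /segment_in_I /= => kn.
have n0 : 0 < n%:R :> R by rewrite ltr0n (leq_trans _ kn).
have len : equi_node R n k.+1 - equi_node R n k = 2 / n%:R.
  by rewrite /equi_node -[k.+1%:R]natr1; field; rewrite gt_eqF.
split=> //; split.
- by rewrite /equi_node lerDl divr_ge0.
- by rewrite -subr_gt0 len divr_gt0.
- rewrite /equi_node -lerBrDl opprK ler_pdivrMr// ler_pM2l ?ler_nat//.
Qed.

Lemma seg_index_spec (n : nat) (x : R) : (0 < n)%N -> -1 <= x <= 1 ->
  (0 < seg_index n x <= n)%N /\
  (equi_seg R n (seg_index n x)).1 <= x <= (equi_seg R n (seg_index n x)).2.
Proof.
move=> n0 /andP[x1 x2]; rewrite /seg_index.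
set P := fun k => _.
have node_n : equi_node R n n = 1.
  by rewrite /equi_node mulfK ?pnatr_eq0 -?lt0n//; ring.
have hP : has P (iota 1 n).
  have ex : exists k, x <= equi_node R n k by exists n; rewrite node_n.
  case: (ex_minnP ex) => k xk kmin.
  have kn : (k <= n)%N by apply: kmin; rewrite node_n.
  (* The least k is 0 only for x = -1, which lies in the first segment. *)
  apply/hasP; case: k xk kmin kn => [|k] xk kmin kn.
    exists 1%N; first by rewrite mem_iota/= add1n.
    rewrite /P /= {1}/equi_node mulr0 mul0r addr0 x1/= (le_trans xk)//.
    by rewrite /equi_node lerD2l ler_pM2r ?invr_gt0 ?ltr0n// ler_pM2l// ler_nat.
  exists k.+1; first by rewrite mem_iota/= add1n.
  rewrite /P /= xk andbT leNgt; apply/negP => /ltW /kmin.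
  by rewrite ltnn.
split; first by have := hP; rewrite has_find size_iota.
have := nth_find 0 hP; rewrite nth_iota ?add1n//.
by have := hP; rewrite has_find size_iota.
Qed.

End equispaced.

Lemma poly_eq0_on_I (R : realType) (p : {poly R}) :
  (forall x, -1 <= x <= 1 -> p.[x] = 0) -> p = 0.
Proof.
move=> p0; apply/eqP/negPn/negP => pn0.
(* The numbers 1 / (k + 1) provide more roots in [-1, 1] than the degree. *)
pose rs : seq R := [seq k.+1%:R^-1 | k <- iota 0 (size p)].
have /(max_poly_roots pn0) : all (root p) rs.
  apply/allP => _ /mapP[k _ ->]; apply/rootP/p0.
  have k0 : 0 < k.+1%:R :> R by rewrite ltr0n.
  have ki0 : 0 < k.+1%:R^-1 :> R by rewrite invr_gt0.
  by rewrite invf_le1// ler1n andbT (le_trans _ (ltW ki0)).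
have ur : uniq rs.
  rewrite map_inj_uniq ?iota_uniq// => i j /invr_inj /eqP.
  by rewrite eqr_nat => /eqP[].
by move=> /(_ ur); rewrite size_map size_iota ltnn.
Qed.

Section stability.
Context {R : realType}.
Variables (m : nat) (S : 'I_m -> R * R) (h L alpha : R).
Hypothesis S_in_I : forall i, segment_in_I (S i).
Hypothesis S_len : forall i, seg_length (S i) = h.
Hypothesis S_node : forall i, (S i).1 <= cheb_node R i <= (S i).2.
Hypothesis alpha1 : alpha < 1.
Hypothesis L_norming : forall (p : {poly R}) (M x : R), (size p <= m)%N ->
  (forall k, (k < m)%N -> `|p.[cos (cheb_angle R m k)]| <= M) ->
  -1 <= x <= 1 -> `|p.[x]| <= L * M.
Hypothesis small : L * (m%:R ^+ 2 * h) <= alpha.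

(** Apply [L_norming] to the values of p at the nodes, each within
    m^2 h B of the corresponding average, where B is the maximum of |p|; by
    [small] the resulting term L m^2 h B is at most alpha B and is absorbed. *)
Lemma seg_norming (p : {poly R}) (E : R) : (size p <= m)%N ->
  (forall i, `|(seg_length (S i))^-1 * seg_integral (S i) p| <= E) ->
  forall x, -1 <= x <= 1 -> `|p.[x]| <= (1 - alpha)^-1 * L * E.
Proof.
move=> pm pE.
have [x0 x01 x0max] : exists2 x0, x0 \in `[-1, 1] &
    forall x, x \in `[-1, 1] -> `|p.[x]| <= `|p.[x0]|.
  apply: (@EVT_max _ (fun x => `|p.[x]|)); first by lra.
  apply: continuous_subspaceT => x.
  by apply: continuous_comp; [exact: continuous_horner|exact: norm_continuous].
set B := `|p.[x0]| in x0max.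
have pB x : -1 <= x <= 1 -> `|p.[x]| <= B.
  by move=> x1; apply: x0max; rewrite in_itv.
have B0 : 0 <= B by exact: normr_ge0.
have node k : (k < m)%N ->
    `|p.[cos (cheb_angle R m k)]| <= E + m%:R ^+ 2 * h * B.
  move=> km; pose i := Ordinal km.
  have [s1 s12 s2] := S_in_I i.
  have K0 : 0 <= 2 * m%:R ^+ 2 * B by rewrite !mulr_ge0.
  have := seg_average_dist s12 (S_node i) K0 (p := p).
  have h1 x : (S i).1 <= x <= (S i).2 -> `|p.[x] - p.[cheb_node R i]| <=
      2 * m%:R ^+ 2 * B * `|x - cheb_node R i|.
    move=> /andP[x1 x2]; apply: (horner_cheb_dist km pm pB).
    by rewrite (le_trans s1 x1) (le_trans x2 s2).
  move=> /(_ h1); have := pE i; rewrite S_len.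
  rewrite -[p.[cos _]]/(p.[cheb_node R i]).
  set y := h^-1 * _ => yE yd.
  rewrite (_ : p.[_] = y - (y - p.[cheb_node R i])); last by ring.
  rewrite (le_trans (ler_normB _ _))// lerD// (le_trans yd)//.
  by rewrite le_eqVlt; apply/predU1P; left; field.
have BE : B <= L * (E + m%:R ^+ 2 * h * B).
  by apply: L_norming => //; rewrite in_itv in x01.
have aB : L * (m%:R ^+ 2 * h) * B <= alpha * B by rewrite ler_wpM2r.
move=> x /pB xB; rewrite (le_trans xB)// -mulrA.
rewrite -[leRHS]mulrC ler_pdivlMr ?subr_gt0//.
by lra.
Qed.

(** A polynomial whose averages all vanish is zero by [seg_norming] with
    E = 0, so the matrix has trivial kernel. *)
Lemma seg_unisolvent : unisolvent S.
Proof.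
split=> //; exists (npolyX R m); first exact: npolyX_full.
rewrite -unitmx_tr -row_free_unit; apply: inj_row_free => v vM.
pose p : {poly R} := \sum_(j < m) v 0 j *: (tnth (npolyX R m) j : {poly R}).
have pj (j : 'I_m) : p`_j = v 0 j.
  rewrite coef_sum (bigD1 j)//= npolyXE coefZ coefXn eqxx mulr1 big1 ?addr0//.
  move=> i /negbTE ij; rewrite npolyXE coefZ coefXn.
  by rewrite (_ : (j == i :> nat) = false) ?mulr0// eq_sym.
have pm : (size p <= m)%N.
  rewrite (leq_trans (size_sum _ _ _))//; apply/bigmax_leqP => j _.
  by rewrite (leq_trans (size_scale_leq _ _))// size_npoly.
have p0 : p = 0.
  apply: poly_eq0_on_I => x x1; apply/normr0_eq0/le_anti.
  rewrite normr_ge0 andbT -[leRHS](mulr0 ((1 - alpha)^-1 * L)).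
  apply: seg_norming => // i; rewrite le_eqVlt; apply/predU1P; left.
  apply/eqP; rewrite normr_eq0; apply/eqP.
  move/matrixP: vM => /(_ 0 i); rewrite !mxE => vMi.
  rewrite -[RHS]vMi seg_integral_sum mulr_sumr; apply: eq_bigr => j _.
  by rewrite !mxE seg_integralZ mulrCA.
by apply/rowP => j; rewrite !mxE -pj p0 coef0.
Qed.

(** The sum of absolute values is the integral of one polynomial, the Lagrange
    basis combined with the signs of its integrals over [s]; its averages over
    the family are these signs, at most 1 in absolute value. *)
Lemma seg_lebesgue_le : 0 <= L ->
  (lebesgue_constant S <= ((1 - alpha)^-1 * L)%:E)%E.
Proof.
move=> L_ge0; have L0 : 0 <= (1 - alpha)^-1 * L.
  by rewrite mulr_ge0 ?invr_ge0 ?subr_ge0 ?(ltW alpha1).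
apply: ge_ereal_sup => _ [s /= [s1 s12 s2] <-]; rewrite lee_fin.
have l0 : 0 < seg_length s by rewrite subr_gt0.
rewrite mulrC ler_pdivrMr//.
rewrite /lagrange_basis; case: xgetP => [l _ ll|_]; last first.
  rewrite big1 ?(mulr_ge0 L0 (ltW l0))// => i _.
  by rewrite tnth_mktuple seg_integral0 normr0.
pose e i := Num.sg (seg_integral s (tnth l i)).
pose p : {poly R} := \sum_(i < m) e i *: (tnth l i : {poly R}).
rewrite (_ : \sum_(i < m) _ = seg_integral s p); last first.
  rewrite seg_integral_sum; apply: eq_bigr => i _.
  by rewrite seg_integralZ /e normrEsg.
rewrite -seg_integralC//; apply: seg_integral_le => x /andP[x1 x2].
rewrite hornerC (le_trans (ler_norm _))// -[leRHS]mulr1.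
apply: seg_norming; last by rewrite (le_trans s1 x1) (le_trans x2 s2).
  rewrite (leq_trans (size_sum _ _ _))//; apply/bigmax_leqP => j _.
  by rewrite (leq_trans (size_scale_leq _ _))// size_npoly.
move=> j; rewrite seg_integral_sum mulr_sumr (bigD1 j)//= big1 ?addr0.
  rewrite seg_integralZ mulrCA ll eqxx mulr1.
  by rewrite /e normr_sg; case: (_ != 0).
(* All segments have length h, so both normalizations agree. *)
move=> i /negbTE ij; have := ll i j; rewrite ij !S_len => li.
by rewrite seg_integralZ mulrCA li mulr0.
Qed.

End stability.

Theorem theorem3 (R : realType) (m : nat) (hm : (1 <= m)%N) (alpha : R)
    (halpha0 : 0 < alpha) (halpha1 : alpha < 1) (n : nat)
    (hn : 2 / alpha * m%:R ^+ 2 * (2 / pi * ln m%:R + 1) <= n%:R) :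
  unisolvent (@mock_cheb_segments R n m) /\
  (lebesgue_constant (@mock_cheb_segments R n m)
     <= ((1 - alpha)^-1 * (2 / pi * ln m%:R + 1))%:E)%E.
Proof.
set L := 2 / pi * ln m%:R + 1 in hn *.
have mR : 0 < m%:R :> R by rewrite ltr0n.
have L0 : 0 < L.
  have lnm : 0 <= ln m%:R :> R by rewrite ln_ge0// ler1n.
  by rewrite ltr_wpDl// mulr_ge0// divr_ge0// pi_ge0.
have n0 : 0 < n%:R :> R.
  by apply: lt_le_trans hn; rewrite !mulr_gt0 ?invr_gt0 ?exprn_gt0.
have n_gt0 : (0 < n)%N by rewrite -(ltr0n R).
have node1 (i : 'I_m) : -1 <= cheb_node R i <= 1 by rewrite cos_geN1 cos_le1.
pose spec i := seg_index_spec n_gt0 (node1 i).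
have sI i : segment_in_I (@mock_cheb_segments R n m i).
  by have [k _] := spec i; have [] := @equi_seg_in_I R n _ k.
have sl i : seg_length (@mock_cheb_segments R n m i) = 2 / n%:R.
  by have [k _] := spec i; have [] := @equi_seg_in_I R n _ k.
have sn i : (@mock_cheb_segments R n m i).1 <= cheb_node R i
    <= (@mock_cheb_segments R n m i).2 by have [_] := spec i.
have small : L * (m%:R ^+ 2 * (2 / n%:R)) <= alpha.
  rewrite !mulrA ler_pdivrMr// -ler_pdivrMl//.
  by rewrite (le_trans _ hn)// le_eqVlt; apply/predU1P; left; field; rewrite gt_eqF.
have Lnorm := @cheb_lebesgue_le R m hm.
split.
  exact: (seg_unisolvent sI sl sn halpha1 Lnorm small).
exact: (seg_lebesgue_le sI sl sn halpha1 Lnorm small (ltW L0)).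
Qed.
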